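(* Let $k,n$ be positive integers and let $M$ be a $(\sqcap,\sqcup)$-closed set on ${S_k}^n$. The number of join-irreducible elements of $M$ is at most $kn$.
   Context: For a positive integer $k$ let $S_k=\{0,1,\dots,k\}$, partially ordered by: $a\preceq b$ if and only if $a\in\{0,b\}$. The product ${S_k}^n$ has the componentwise order, also denoted $\preceq$; subsets carry the induced order. For $x,y\in{S_k}^n$ define $x\sqcap y$ and $x\sqcup y$ componentwise: if $x_i,y_i$ are comparable in $\preceq$, then $(x\sqcap y)_i=\min\{x_i,y_i\}$ and $(x\sqcup y)_i=\max\{x_i,y_i\}$ (with respect to $\preceq$); otherwise $(x\sqcap y)_i=(x\sqcup y)_i=0$. A nonempty subset of ${S_k}^n$ is $(\sqcap,\sqcup)$-closed if it is closed under both operations; such a set is a meet-semilattice under $\preceq$. An element of $M$ is join-irreducible if it is not the minimum of $M$ and is not represented as a join (in $M$) of other elements of $M$. *)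

(* Defs.v *)
From HB Require Import structures.
From mathcomp Require Import all_boot all_order.

Set Implicit Arguments.
Unset Strict Implicit.
Unset Printing Implicit Defensive.

Import Order.TTheory.
Local Open Scope order_scope.

(* A copy of 'I_k.+1, to keep the order below apart from the usual one. *)
Definition star (k : nat) := 'I_k.+1.

HB.instance Definition _ (k : nat) := Finite.copy (star k) 'I_k.+1.

Definition star0 {k : nat} : star k := ord0.

Section StarOrder.
Variable k : nat.
Implicit Types a b c : star k.

Definition star_le a b := (a == star0) || (a == b).

Lemma star_le_refl : reflexive star_le.
Proof. by move=> a; rewrite /star_le eqxx orbT. Qed.

Lemma star_le_anti : antisymmetric star_le.
Proof.
by move=> a b /andP[/orP[/eqP->|/eqP->] // /orP[/eqP->|/eqP->]].
Qed.

Lemma star_le_trans : transitive star_le.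
Proof.
by move=> b a c /orP[/eqP->|/eqP->].
Qed.

End StarOrder.

Fact star_display : Order.disp_t. Proof. exact: Order.Disp tt tt. Qed.

HB.instance Definition _ (k : nat) :=
  Order.Le_isPOrder.Build star_display (star k)
    (@star_le_refl k) (@star_le_anti k) (@star_le_trans k).

(* [n.-tupleprod T] is [n.-tuple T] with the componentwise order. *)
Notation starprod k n := (n.-tupleprod (star k)).

Definition star_cap k (a b : star k) : star k :=
  if a >=< b then Order.min a b else star0.

Definition star_cup k (a b : star k) : star k :=
  if a >=< b then Order.max a b else star0.

Definition sqcap k n (x y : starprod k n) : starprod k n :=
  [tuple star_cap (tnth x i) (tnth y i) | i < n].

Definition sqcup k n (x y : starprod k n) : starprod k n :=
  [tuple star_cup (tnth x i) (tnth y i) | i < n].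

Definition sqcap_sqcup_closed k n (M : {set starprod k n}) : Prop :=
  [/\ M != set0,
      {in M &, forall x y, sqcap x y \in M}
    & {in M &, forall x y, sqcup x y \in M}].

Section JoinIrreducible.
Context {d : Order.disp_t} {T : finPOrderType d}.
Implicit Types (M A : {set T}) (x : T).

Definition is_minimum M x := (x \in M) && [forall y in M, x <= y].

Definition upper_bounds M A := [set y in M | [forall a in A, a <= y]].

(* The join is taken in M with the induced order, so it need not be the join
   in T, nor be given by [sqcup]. *)
Definition is_join M A x := is_minimum (upper_bounds M A) x.

Definition join_irreducibles M : {set T} :=
  [set x in M | ~~ is_minimum M x &
     ~~ [exists A : {set T}, (A \subset M :\ x) && is_join M A x]].

End JoinIrreducible.

(* Main.v *)
Require Import Defs.
From mathcomp Require Import all_boot all_order.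

(** Fix a coordinate [i] and a nonzero value [a].  The elements [y] of [M] with
[y_i = a] are closed under [sqcap], so if there are any, they have a least one.
There are [k * n] pairs [(i, a)], and every join-irreducible [x] is least in
this sense for some pair ([join_irreducible_min_fiber]), which gives the bound
([card_le_rel] does the counting).

To see this, suppose that [x] is least for none of its pairs [(i, x_i)] with
[x_i] nonzero.  Then for each such [i] there is [y] in [M] with [y_i = x_i] and
not [x <= y], so that [sqcap x y] is an element of [M] strictly below [x] with
the same coordinate [i] as [x].  Hence an element above all the elements of [M]
strictly below [x] is above [x] in each coordinate, and [x] is the join of
these elements, so it is not join-irreducible. *)

Import Order.TTheory.
Local Open Scope order_scope.

Lemma star0_le (k : nat) (a : star k) : star0 <= a.
Proof. by rewrite /Order.le /= /star_le eqxx. Qed.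

Lemma star_capxx (k : nat) (a : star k) : star_cap a a = a.
Proof. by rewrite /star_cap comparablexx minxx. Qed.

Lemma star_cap_lel (k : nat) (a b : star k) : star_cap a b <= a.
Proof.
rewrite /star_cap; case: ifP => [cmp_ab|_]; last exact: star0_le.
by rewrite comparable_ge_min // lexx.
Qed.

Lemma star_capC (k : nat) (a b : star k) : star_cap a b = star_cap b a.
Proof.
rewrite /star_cap [b >=< a]comparable_sym.
by case: ifP => // /comparable_minC.
Qed.

Lemma tnth_sqcap (k n : nat) (x y : starprod k n) (i : 'I_n) :
  tnth (sqcap x y) i = star_cap (tnth x i) (tnth y i).
Proof. exact: tnth_mktuple. Qed.

Lemma starprod_leP (k n : nat) (x y : starprod k n) :
  reflect (forall i, tnth x i <= tnth y i) (x <= y).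
Proof. by rewrite Order.TupleProdOrder.leEtprod; apply: forallP. Qed.

Lemma sqcap_lel (k n : nat) (x y : starprod k n) : sqcap x y <= x.
Proof. by apply/starprod_leP => i; rewrite tnth_sqcap star_cap_lel. Qed.

Lemma sqcap_ler (k n : nat) (x y : starprod k n) : sqcap x y <= y.
Proof. by apply/starprod_leP => i; rewrite tnth_sqcap star_capC star_cap_lel. Qed.

Lemma is_minimum_uniq (d : Order.disp_t) (T : finPOrderType d) (M : {set T})
    (x y : T) : is_minimum M x -> is_minimum M y -> x = y.
Proof.
move=> /andP[Mx /forall_inP lex] /andP[My /forall_inP ley].
by apply: le_anti; rewrite lex ?ley.
Qed.

(** Among the sets of other elements of [M] that could have join [x], the largest
is the set of those strictly below [x].  As [x] bounds it, [x] can only fail to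
be its join because some other upper bound is not above [x]. *)
Lemma join_irreducible_bound {d : Order.disp_t} {T : finPOrderType d}
    {M : {set T}} {x : T} : x \in join_irreducibles M ->
  exists2 z, z \in upper_bounds M [set y in M | y < x] & ~~ (x <= z).
Proof.
rewrite inE => /and3P[Mx _ /existsPn/(_ [set y in M | y < x])].
rewrite negb_and; case/orP=> [/subsetP[]|].
  by move=> y; rewrite !inE lt_neqAle => /and3P[-> ->].
rewrite /is_join /is_minimum negb_and.
have -> /= : x \in upper_bounds M [set y in M | y < x].
  by rewrite inE Mx; apply/forall_inP => y; rewrite inE => /andP[_ /ltW].
by case/forall_inPn => z ubz nle_xz; exists z.
Qed.

Definition fiber {k n : nat} (M : {set starprod k n}) (p : 'I_n * star k) :=
  [set y in M | tnth y p.1 == p.2].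

(** This is the step where closure under [sqcap] enters: it turns an element of
the fiber that is not above [x] into one strictly below [x]. *)
Lemma join_irreducible_min_fiber (k n : nat) (M : {set starprod k n}) :
    {in M &, forall x y, sqcap x y \in M} ->
  forall x, x \in join_irreducibles M ->
  exists2 p, p \in setX [set: 'I_n] [set~ star0] & is_minimum (fiber M p) x.
Proof.
move=> capM x JIx; have Mx : x \in M by move: JIx; rewrite inE => /andP[].
have [z] := join_irreducible_bound JIx.
rewrite inE => /andP[_ /forall_inP ubz].
(* [x] is least in its fiber over any coordinate where [x <= z] fails. *)
rewrite Order.TupleProdOrder.leEtprod => /forallPn[i nle_xz].
exists (i, tnth x i).
  by rewrite !inE /=; apply: contraNneq nle_xz => ->; apply: star0_le.
rewrite /is_minimum inE Mx eqxx /=; apply/forall_inP => y.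
rewrite inE => /andP[My /= /eqP yi]; apply: contraNT nle_xz => nle_xy.
have /ubz/starprod_leP/(_ i) : sqcap x y \in [set y in M | y < x].
  rewrite inE capM //= lt_neqAle sqcap_lel andbT.
  by apply: contraNneq nle_xy => {1}<-; apply: sqcap_ler.
by rewrite tnth_sqcap yi star_capxx.
Qed.

(** As [p] determines [x], [R] is the graph of a partial map from [T] to [S], and
this map covers [A] from [B]. *)
Lemma card_le_rel {S T : finType} {A : {set S}} {B : {set T}}
    (R : S -> T -> bool) :
    (forall x, x \in A -> exists2 p, p \in B & R x p) ->
    (forall x y p, R x p -> R y p -> x = y) ->
  (#|A| <= #|B|)%N.
Proof.
move=> R_total R_inj; rewrite -(card_imset (mem A) Some_inj).
pose g p := [pick x | R x p].
apply: leq_trans (leq_imset_card g (mem B)).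
apply/subset_leq_card/subsetP => _ /imsetP[x Ax ->].
have [p Bp Rxp] := R_total x Ax; apply/imsetP; exists p => //.
rewrite /g; case: pickP => [y Ryp|/(_ x)]; last by rewrite Rxp.
by rewrite (R_inj _ _ _ Rxp Ryp).
Qed.

Theorem proposition5 (k n : nat) (k_gt0 : (0 < k)%N) (n_gt0 : (0 < n)%N)
    (M : {set starprod k n}) (M_closed : sqcap_sqcup_closed M) :
  (#|join_irreducibles M| <= k * n)%N.
Proof.
have [_ capM _] := M_closed.
have -> : (k * n)%N = #|setX [set: 'I_n] [set~ @star0 k]|.
  by rewrite cardsX cardsT cardsC1 !card_ord mulnC.
apply: (card_le_rel (fun x p => is_minimum (fiber M p) x)).
  exact: join_irreducible_min_fiber.
by move=> x y p; apply: is_minimum_uniq.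
Qed.
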